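(* Consider the semi-Lagrangian discretization, on a simplicial mesh of $\overline\Omega\subset\mathbb R^n$ with vertex set $X$ and minimum edge-length $h$, of the isotropic (Eikonal) problem with speed $f(x)$, $0<F_1\le f(x)\le F_2$: $$U(x)=\min_{m\in\mathcal M(x)}\min_{\xi\in\Xi_n}\Big\{\frac{\tau^m(\xi)}{f(x)}+\sum_{i=1}^n\xi_iU(z^m_i)\Big\}\ \ (x\in X\cap\Omega),\qquad U(x)=q(x)\ \ (x\in X\cap\partial\Omega).$$ Suppose the mesh is acute, i.e. $\beta<\pi/2$. Then every mode $m\in\mathcal M(x)$, $x\in X\cap\Omega$, is absolutely causal, and the Dijkstra-like method is applicable. Moreover, the costs $C^m(x,\xi)=\tau^m(\xi)/f(x)$ satisfy $$\frac{\partial C^m}{\partial\xi_j}(x,\xi)\ \ge\ \delta:=\frac{h\cos\beta}{F_2}>0\qquad\text{for all }x\in X\cap\Omega,\ m\in\mathcal M(x),\ \xi\in\Xi_n,\ j=1,\dots,n,$$ and the Dial-like method with buckets of width $\delta$ is applicable.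
   Context: $\Xi_n=\{\xi\in\mathbb R^n:\xi_1+\dots+\xi_n=1,\ \xi_j\ge0\}$; $\mathbb R^n_{+,0}=\{W\in\mathbb R^n:W_j\ge 0\ \forall j\}$. Setting. $\Omega\subset\mathbb R^n$ is a bounded domain whose closure is triangulated by a finite nondegenerate simplicial mesh with vertex set $X$; $h$ is the minimum edge-length. The speed $f$ is Lipschitz-continuous with $0<F_1\le f\le F_2$, and the boundary penalty $q:\partial\Omega\to[0,\infty)$ is Lipschitz-continuous. For $x\in X\cap\Omega$, each mesh simplex having $x$ as a vertex gives one mode $m=(z^m_1,\dots,z^m_n)\in\mathcal M(x)$ consisting of its other $n$ vertices. For a nonzero $\xi$ with nonnegative entries, $\tau^m(\xi)=\big\|\sum_{i=1}^n\xi_i(z^m_i-x)\big\|$ (Euclidean norm; homogeneous of degree one in $\xi$); on $\Xi_n$ this is the distance from $x$ to $\sum_i\xi_iz^m_i$. Partial derivatives in $\xi_j$ are those of this homogeneous extension. $\beta$ is the maximum, over all $x\in X\cap\Omega$, $m\in\mathcal M(x)$ and $i,k\in\{1,\dots,n\}$, of the angle between $z^m_i-x$ and $z^m_k-x$. $U$ is the value function of the stochastic shortest path problem on $X\cup\{t\}$ with absorbing cost-free target $t$, $U(t)=0$: at $x\in X\cap\partial\Omega$ the only transition is deterministic to $t$ with cost $q(x)$; at $x\in X\cap\Omega$ one chooses $m\in\mathcal M(x)$ and $\xi\in\Xi_n$, pays $C^m(x,\xi)=\tau^m(\xi)/f(x)$, and moves to $z^m_j$ with probability $\xi_j$. $U(x)$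 is the infimum over policies of the expected total cost accumulated from $x$; it satisfies the displayed system. A mode $m\in\mathcal M(x)$ is absolutely causal if for every $W\in\mathbb R^n_{+,0}$, with $V(W)=\min_{\xi\in\Xi_n}\{C^m(x,\xi)+\xi^TW\}$, every minimizer $\xi^*$ and every $j$: $\xi^*_j>0$ implies $V(W)>W_j$. Label-setting methods. All nodes of $X$ start in the tentative list $L$, with the permanent list $P$ empty; the initial labels are $q(x)$ for $x\in X\cap\partial\Omega$ and $+\infty$ for $x\in X\cap\Omega$. Dijkstra-like method: repeatedly move a node $\bar x\in L$ with the smallest label to $P$, then replace the label of each $x\in L\cap\Omega$ by the minimum of its current value and $\inf\{C^m(x,\xi)+\sum_j\xi_jU(z^m_j)\}$ over all $m\in\mathcal M(x)$ and $\xi\in\Xi_n$ putting positive weight on $\bar x$ and zero weight on all nodes not in $P$ (using labels of nodes in $P$); stop when $L$ is empty. Dial-like method with buckets of width $\delta$: nodes of $L$ with finite labels are kept in buckets $[k\delta,(k+1)\delta)$, $k=0,1,\dots$; at each stage all nodes in the first nonempty bucket are simultaneously moved to $P$, then the labels of nodes $x\in L\cap\Omega$ are replaced by the minimum of the current label and $\inf\{C^m(x,\xi)+\sum_j\xi_jU(z^m_j)\}$ over $m\in\mathcal M(x)$ and $\xi\in\Xi_n$ with zero weight on all nodes not in $P$, the nodes are re-bucketed, and the method continues until $L$ is empty. A method is applicable if upon termination every label equals $U(x)$. *)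

(* Defs.v *)
From HB Require Import structures.
From mathcomp Require Import all_boot all_order all_algebra.
From mathcomp Require Import all_classical all_reals all_analysis.

Set Implicit Arguments.
Unset Strict Implicit.
Unset Printing Implicit Defensive.

Import Order.TTheory GRing.Theory Num.Theory.
Import numFieldNormedType.Exports.

Local Open Scope classical_set_scope.
Local Open Scope ring_scope.

Section Euclidean.
Context {R : realType} {n : nat}.
Implicit Types u v : 'rV[R]_n.

Definition dotv u v : R := \sum_(i < n) u 0 i * v 0 i.

(* The norm `|u| of the library on 'rV[R]_n is the sup norm. *)
Definition enorm u : R := Num.sqrt (dotv u u).

Definition angle u v : R := acos (dotv u v / (enorm u * enorm v)).

Definition Xi : set 'rV[R]_n :=
  [set xi | (forall j, 0 <= xi 0 j) /\ \sum_(j < n) xi 0 j = 1].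

End Euclidean.

(* A mesh is given by a finite type V of vertices, their positions in R^n and
   the set of the vertex sets of its simplices. *)
Section Mesh.
Context {R : realType} {n : nat} {V : finType}.
Variable pos : V -> 'rV[R]_n.

Definition simplex_hull (S : {set V}) : set 'rV[R]_n :=
  [set p | exists w : V -> R,
    [/\ forall v, 0 <= w v, \sum_(v in S) w v = 1
      & p = \sum_(v in S) w v *: pos v]].

Definition affinely_independent (S : {set V}) : Prop :=
  forall w : V -> R,
    \sum_(v in S) w v = 0 -> \sum_(v in S) w v *: pos v = 0 ->
    forall v, v \in S -> w v = 0.

Record triangulation (A : set 'rV[R]_n) (mesh : {set {set V}}) : Prop := {
  tri_pos_inj : injective pos ;
  tri_vertex : forall x, exists2 S, S \in mesh & x \in S ;
  tri_card : forall S, S \in mesh -> #|S| = n.+1 ;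
  tri_nondegenerate : forall S, S \in mesh -> affinely_independent S ;
  (* two simplices meet exactly in the face spanned by their common vertices,
     which is empty when they have none *)
  tri_conforming : forall S T, S \in mesh -> T \in mesh ->
    simplex_hull S `&` simplex_hull T = simplex_hull (S :&: T)%SET ;
  tri_cover : \bigcup_(S in [set` mesh]) simplex_hull S = A }.

Definition min_edge (mesh : {set {set V}}) : R :=
  inf [set d | exists S u v,
    [/\ S \in mesh, u \in S, v \in S, u != v & d = enorm (pos u - pos v)]].

(* The mode of x given by a simplex S containing x is represented by S itself;
   mode_vertex x S i is its (i+1)-st component. *)
Definition modes (mesh : {set {set V}}) (x : V) : {set {set V}} :=
  [set S in mesh | x \in S]%SET.

Definition mode_vertex (x : V) (S : {set V}) (i : 'I_n) : V :=
  nth x (enum (S :\ x)%SET) i.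

(* Equal to 0 when there is no vertex in Omega, as sup set0 = 0. *)
Definition max_angle (Omega : set 'rV[R]_n) (mesh : {set {set V}}) : R :=
  sup [set a | exists x S i k, [/\ pos x \in Omega, S \in modes mesh x &
    a = angle (pos (mode_vertex x S i) - pos x)
              (pos (mode_vertex x S k) - pos x)]].

Definition tau (x : V) (S : {set V}) (xi : 'rV[R]_n) : R :=
  enorm (\sum_(i < n) xi 0 i *: (pos (mode_vertex x S i) - pos x)).

Definition mode_cost (f : 'rV[R]_n -> R) (x : V) (S : {set V})
  (xi : 'rV[R]_n) : R := tau x S xi / f (pos x).

End Mesh.

Section AbsoluteCausality.
Context {R : realType} {n : nat}.
Variable C : 'rV[R]_n -> R.

Definition mode_objective (W xi : 'rV[R]_n) : R := C xi + dotv xi W.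

Definition mode_value (W : 'rV[R]_n) : R := inf (mode_objective W @` Xi).

Definition mode_minimizer (W xi : 'rV[R]_n) : Prop :=
  Xi xi /\ forall eta, Xi eta -> mode_objective W xi <= mode_objective W eta.

Definition absolutely_causal : Prop :=
  forall W : 'rV[R]_n, (forall j, 0 <= W 0 j) ->
  forall xi, mode_minimizer W xi ->
  forall j, 0 < xi 0 j -> W 0 j < mode_value W.

End AbsoluteCausality.

Section ShortestPath.
Context {R : realType} {n : nat} {V : finType}.
Variables (Omega : set 'rV[R]_n) (pos : V -> 'rV[R]_n) (mesh : {set {set V}}).
Variables (f q : 'rV[R]_n -> R).

(* The states are the vertices, together with None for the target t. *)
Definition control : Type := ({set V} * 'rV[R]_n)%type.

(* The control at a vertex of the boundary is irrelevant. *)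
Definition control_mapping (mu : V -> control) : Prop :=
  forall x, pos x \in Omega -> (mu x).1 \in modes mesh x /\ Xi (mu x).2.

Definition transition (mu : V -> control) (s s' : option V) : R :=
  match s with
  | None => (s' == None)%:R
  | Some x =>
      if pos x \in Omega then
        \sum_(j < n) (mu x).2 0 j *
                     (s' == Some (mode_vertex x (mu x).1 j))%:R
      else (s' == None)%:R
  end.

Definition stage_cost (mu : V -> control) (s : option V) : R :=
  match s with
  | None => 0
  | Some x =>
      if pos x \in Omega then mode_cost pos f x (mu x).1 (mu x).2
      else q (pos x)
  end.

(* A policy is a sequence of control mappings, pi k being used at time k. *)
Definition policy (pi : nat -> V -> control) : Prop :=
  forall k, control_mapping (pi k).

(* Probability that the process started from s is in state s' at time k. *)
Fixpoint state_law (pi : nat -> V -> control) (s : option V) (k : nat)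
    (s' : option V) : R :=
  if k is k'.+1 then
    \sum_(s'' : option V) state_law pi s k' s'' * transition (pi k') s'' s'
  else (s' == s)%:R.

Definition expected_cost (pi : nat -> V -> control) (s : option V) : \bar R :=
  (\sum_(0 <= k <oo)
     (\sum_(s' : option V) state_law pi s k s' * stage_cost (pi k) s')%R%:E)%E.

Definition value (s : option V) : \bar R :=
  ereal_inf [set expected_cost pi s | pi in policy].

(* The convention 0 * +oo = 0 of the library makes the labels of the vertices
   of zero weight irrelevant, even when they are infinite. *)
Definition one_step (W : V -> \bar R) (x : V) (S : {set V}) (xi : 'rV[R]_n)
    : \bar R :=
  ((mode_cost pos f x S xi)%:E
     + \sum_(j < n) (xi 0 j)%:E * W (mode_vertex x S j))%E.

Definition attained_min (m : \bar R) (A : set (\bar R)) : Prop :=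
  A m /\ forall a, A a -> (m <= a)%E.

Definition solves_discretization (U : V -> \bar R) : Prop :=
  forall x, if pos x \in Omega
    then attained_min (U x) [set a | exists S xi,
           [/\ S \in modes mesh x, Xi xi & a = one_step U x S xi]]
    else U x = (q (pos x))%:E.

(* A state of a label-setting method is the permanent list P with the current
   labels; the tentative list L is the complement of P. *)
Definition method_state : Type := ({set V} * (V -> \bar R))%type.

Definition initial_state : method_state :=
  (finset.set0, fun x => if pos x \in Omega then +oo%E else (q (pos x))%:E).

Definition supported (P : {set V}) (x : V) (S : {set V}) (xi : 'rV[R]_n)
    : Prop :=
  forall j, mode_vertex x S j \notin P -> xi 0 j = 0.

Definition dijkstra_candidates (P : {set V}) (lab : V -> \bar R) (xbar x : V)
    : set (\bar R) :=
  [set a | exists S xi,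
    [/\ S \in modes mesh x, Xi xi, supported P x S xi,
        exists2 j, mode_vertex x S j = xbar & 0 < xi 0 j
      & a = one_step lab x S xi]].

Definition dijkstra_step (s s' : method_state) : Prop :=
  exists xbar, [/\ xbar \notin s.1,
    forall y, y \notin s.1 -> (s.2 xbar <= s.2 y)%E,
    s'.1 = (xbar |: s.1)%SET
  & forall x, s'.2 x =
      if (x \notin s'.1) && (pos x \in Omega)
      then Order.min (s.2 x)
             (ereal_inf (dijkstra_candidates s'.1 s.2 xbar x))
      else s.2 x].

Definition in_bucket (delta : R) (k : nat) (s : method_state) (x : V) : Prop :=
  x \notin s.1 /\ ((k%:R * delta)%:E <= s.2 x < (k.+1%:R * delta)%:E)%E.

Definition dial_candidates (P : {set V}) (lab : V -> \bar R) (x : V)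
    : set (\bar R) :=
  [set a | exists S xi,
    [/\ S \in modes mesh x, Xi xi, supported P x S xi
      & a = one_step lab x S xi]].

Definition dial_step (delta : R) (s s' : method_state) : Prop :=
  exists k, [/\ exists x, in_bucket delta k s x,
    forall k' x, (k' < k)%N -> ~ in_bucket delta k' s x,
    forall x, x \in s'.1 <-> x \in s.1 \/ in_bucket delta k s x
  & forall x, s'.2 x =
      if (x \notin s'.1) && (pos x \in Omega)
      then Order.min (s.2 x) (ereal_inf (dial_candidates s'.1 s.2 x))
      else s.2 x].

(* From the given state the method never gets stuck and, whichever way ties are
   broken, it terminates (L becomes empty) with every label correct. *)
Inductive ends_correctly (step : method_state -> method_state -> Prop)
    (U : V -> \bar R) : method_state -> Prop :=
  | ends_now s : s.1 = [set: V]%SET -> (forall x, s.2 x = U x) ->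
      ends_correctly step U s
  | ends_later s : s.1 <> [set: V]%SET -> (exists s', step s s') ->
      (forall s', step s s' -> ends_correctly step U s') ->
      ends_correctly step U s.

Definition applicable (step : method_state -> method_state -> Prop) : Prop :=
  ends_correctly step (fun x => value (Some x)) initial_state.

End ShortestPath.

(* Main.v *)
Require Import Defs.
From HB Require Import structures.
From mathcomp Require Import all_boot all_order all_algebra.
From mathcomp Require Import all_classical all_reals all_analysis.
From mathcomp Require Import ring lra.

(** In an acute mesh the edges [u_i] leaving [x] satisfy
    [u_i . u_k >= cos beta |u_i| |u_k|], hence
    [|w + t u_j| >= |w| + t cos beta |u_j|] for [w] in their cone and [t >= 0]:
    adding weight [t] to the j-th vertex raises the homogeneous cost by at
    least [t * delta].  Deleting the j-th component of a minimizer [xi*] with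
    [xi*_j > 0] then gives [V(W) >= W_j + delta].

    Perron's method yields a finite solution [W] of the discretized system; a
    supersolution is an affine function of a coordinate of [x], because every
    interior vertex has a mode vertex lying strictly further in any given
    coordinate direction.  [W] equals the value function: for every policy
    [W(x)] is at most the cost accumulated up to a stage plus a multiple of the
    cost of that stage, and the policy greedy for [W] accumulates at most [W(x)].

    In both methods the labels stay above [W] and below every candidate that is
    supported on [P].  A vertex is therefore labelled correctly as soon as all
    vertices with values at most [W(x) - delta] are in [P]; this covers the
    tentative vertices of least value, and the whole first nonempty bucket. *)

Set Implicit Arguments.
Unset Strict Implicit.
Unset Printing Implicit Defensive.

Import Order.TTheory GRing.Theory Num.Theory.
Import numFieldNormedType.Exports.

Local Open Scope classical_set_scope.
Local Open Scope ring_scope.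

(** * Euclidean geometry: angles, cones and the derivative of the norm *)

Section EuclideanGeometry.
Context {R : realType} {n : nat}.
Implicit Types (u v w xi eta W : 'rV[R]_n) (c eps : R).

Lemma dotvC u v : dotv u v = dotv v u.
Proof. by apply: eq_bigr => i _; rewrite mulrC. Qed.

Lemma dotvDl u v w : dotv (u + v) w = dotv u w + dotv v w.
Proof. by rewrite -big_split; apply: eq_bigr => i _; rewrite mxE mulrDl. Qed.

Lemma dotvZl c u v : dotv (c *: u) v = c * dotv u v.
Proof. by rewrite /dotv mulr_sumr; apply: eq_bigr => i _; rewrite mxE mulrA. Qed.

Lemma dotvDr u v w : dotv u (v + w) = dotv u v + dotv u w.
Proof. by rewrite dotvC dotvDl !(dotvC u). Qed.

Lemma dotvZr c u v : dotv u (c *: v) = c * dotv u v.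
Proof. by rewrite dotvC dotvZl dotvC. Qed.

Lemma dotv_suml m (xi : 'I_m -> R) (u : 'I_m -> 'rV[R]_n) w :
  dotv (\sum_(i < m) xi i *: u i) w = \sum_(i < m) xi i * dotv (u i) w.
Proof.
elim/big_ind2: _ => [|x1 x2 y1 y2 <- <-|i _].
- by rewrite /dotv big1 // => i _; rewrite mxE mul0r.
- by rewrite dotvDl.
- by rewrite dotvZl.
Qed.

Lemma dotv_ge0 u : 0 <= dotv u u.
Proof. by apply: sumr_ge0 => i _; rewrite -expr2 sqr_ge0. Qed.

Lemma dotv_eq0 u : (dotv u u == 0) = (u == 0).
Proof.
apply/eqP/eqP => [/psumr_eq0P u0|->]; last first.
  by rewrite /dotv big1 // => i _; rewrite mxE mul0r.
apply/rowP => i; rewrite mxE; apply/eqP.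
by rewrite -sqrf_eq0 expr2 u0 // => j _; rewrite -expr2 sqr_ge0.
Qed.

Lemma enorm_ge0 u : 0 <= enorm u. Proof. exact: sqrtr_ge0. Qed.

Lemma sqr_enorm u : enorm u ^+ 2 = dotv u u.
Proof. by rewrite sqr_sqrtr ?dotv_ge0. Qed.

Lemma enorm_eq0 u : (enorm u == 0) = (u == 0).
Proof. by rewrite -sqrf_eq0 sqr_enorm dotv_eq0. Qed.

Lemma enorm_gt0 u : (0 < enorm u) = (u != 0).
Proof. by rewrite lt0r enorm_ge0 andbT enorm_eq0. Qed.

Lemma enorm0 : enorm (0 : 'rV[R]_n) = 0.
Proof. by apply/eqP; rewrite enorm_eq0. Qed.

Lemma enormZ c u : 0 <= c -> enorm (c *: u) = c * enorm u.
Proof.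
move=> c0; apply/eqP; rewrite -(eqrXn2 (n := 2)) ?enorm_ge0//; last first.
  by rewrite mulr_ge0 ?enorm_ge0.
by rewrite exprMn !sqr_enorm dotvZl dotvZr mulrA.
Qed.

Lemma cauchy_schwarz u v : dotv u v <= enorm u * enorm v.
Proof.
have [->|u0] := eqVneq u 0.
  by rewrite enorm0 mul0r /dotv big1 // => i _; rewrite mxE mul0r.
have [->|v0] := eqVneq v 0.
  by rewrite enorm0 mulr0 /dotv big1 // => i _; rewrite mxE mulr0.
have eu : 0 < enorm u by rewrite enorm_gt0.
have ev : 0 < enorm v by rewrite enorm_gt0.
have := dotv_ge0 (enorm v *: u + (- enorm u) *: v).
rewrite !(dotvDl, dotvDr, dotvZl, dotvZr) -!sqr_enorm (dotvC v u) => H.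
have {}H : 0 <= 2 * (enorm u * enorm v) * (enorm u * enorm v - dotv u v).
  by apply: le_trans H _; rewrite le_eqVlt; apply/orP; left; apply/eqP; ring.
by move: H; rewrite pmulr_rge0 ?subr_ge0// !mulr_gt0.
Qed.

Lemma enormD u v : enorm (u + v) <= enorm u + enorm v.
Proof.
rewrite -(@ler_pXn2r _ 2) ?nnegrE ?addr_ge0 ?enorm_ge0//.
rewrite sqrrD !sqr_enorm dotvDl !dotvDr (dotvC v u).
by have := cauchy_schwarz u v; lra.
Qed.

Lemma enorm_sum m (xi : 'I_m -> R) (u : 'I_m -> 'rV[R]_n) :
  (forall i, 0 <= xi i) ->
  enorm (\sum_(i < m) xi i *: u i) <= \sum_(i < m) xi i * enorm (u i).
Proof.
move=> xi0; elim/big_ind2: _ => [|x1 x2 y1 y2 h1 h2|i _].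
- by rewrite enorm0.
- by apply: le_trans (enormD _ _) _; exact: lerD.
- by rewrite enormZ.
Qed.

(** [acos] inverts [cos] only on [-1, 1], where Cauchy-Schwarz for [u] and for its opposite places
    the normalized product; then [cos] is decreasing on [0, pi]. *)
Lemma cos_bound_of_angle u v (b : R) : u != 0 -> v != 0 ->
  angle u v <= b <= pi ->
  cos b * (enorm u * enorm v) <= dotv u v.
Proof.
move=> u0 v0 /andP[ab bpi].
have uv0 : 0 < enorm u * enorm v by rewrite mulr_gt0 ?enorm_gt0.
rewrite -ler_pdivlMr //.
have r1 : -1 <= dotv u v / (enorm u * enorm v) <= 1.
  rewrite ler_pdivlMr // ler_pdivrMr // mul1r cauchy_schwarz andbT.
  have := cauchy_schwarz ((-1) *: u) v.
  have -> : enorm ((-1) *: u) = enorm u.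
    by rewrite /enorm dotvZl dotvZr !mulN1r opprK.
  by rewrite dotvZl; lra.
have a0 : 0 <= angle u v by exact: acos_ge0.
rewrite -[leRHS]acosK ?in_itv//= leNgt ltr_cos -?leNgt// in_itv/= -/(angle u v).
  by rewrite bpi (le_trans a0 ab).
by rewrite a0 (le_trans ab bpi).
Qed.

(* Splitting [|w + eps u|^2] and using [c <= 1] on the last term. *)
Lemma enorm_increment u w c eps : 0 <= c <= 1 -> 0 <= eps ->
  c * (enorm w * enorm u) <= dotv w u ->
  enorm w + eps * (c * enorm u) <= enorm (w + eps *: u).
Proof.
move=> /andP[c0 c1] eps0 H.
rewrite -(@ler_pXn2r _ 2) ?nnegrE ?addr_ge0 ?mulr_ge0 ?enorm_ge0//.
rewrite sqrrD !sqr_enorm !(dotvDl, dotvDr, dotvZl, dotvZr) (dotvC u w).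
have -> : (eps * (c * enorm u)) ^+ 2 = eps * (eps * dotv u u) * c ^+ 2.
  by rewrite -sqr_enorm; ring.
have H1 : eps * (eps * dotv u u) * c ^+ 2 <= eps * (eps * dotv u u).
  by rewrite ler_piMr ?mulr_ge0 ?dotv_ge0// exprn_ile1.
have H2 := ler_wpM2l eps0 H.
have -> : enorm w * (eps * (c * enorm u)) *+ 2 =
  eps * (c * (enorm w * enorm u)) *+ 2 by ring.
lra.
Qed.

(** An angle bound against each generator passes to their cone: the right side is additive, and the
    triangle inequality bounds the norm on the left. *)
Lemma enorm_cone_cos m (xi : 'I_m -> R) (u : 'I_m -> 'rV[R]_n) w c :
  0 <= c -> (forall i, 0 <= xi i) ->
  (forall i, c * (enorm (u i) * enorm w) <= dotv (u i) w) ->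
  c * (enorm (\sum_(i < m) xi i *: u i) * enorm w) <=
    dotv (\sum_(i < m) xi i *: u i) w.
Proof.
move=> c0 xi0 H; rewrite dotv_suml.
apply: (@le_trans _ _ (c * ((\sum_(i < m) xi i * enorm (u i)) * enorm w))).
  by rewrite ler_wpM2l// ler_wpM2r ?enorm_ge0//; exact: enorm_sum.
rewrite mulr_suml mulr_sumr ler_sum// => i _.
apply: le_trans (ler_wpM2l (xi0 i) (H i)).
by rewrite le_eqVlt; apply/orP; left; apply/eqP; ring.
Qed.

(** Along a line through [w] the norm is the square root of a quadratic in [t], positive at 0
    because [w != 0]. *)
Lemma is_derive_enorm u w : w != 0 ->
  is_derive w u (@enorm R n) (dotv w u / enorm w).
Proof.
move=> w0.
pose g (t : R) := Num.sqrt (dotv w w + t * (2 * dotv w u) + t ^+ 2 * dotv u u).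
have g0 : 0 < dotv w w + 0 * (2 * dotv w u) + 0 ^+ 2 * dotv u u.
  by rewrite expr0n /= !mul0r !addr0 lt0r dotv_ge0 dotv_eq0 w0.
have dg : is_derive (0 : R) 1 g (dotv w u / enorm w).
  (* [p] is assembled from operations on functions, so that the differentiation rules for sums,
     products and powers apply to it as it stands. *)
  pose p := (cst (dotv w w) : R -> R) + ((id : R -> R) * cst (2 * dotv w u) +
    (id : R -> R) ^+ 2 * cst (dotv u u)).
  have pE t : p t = dotv w w + t * (2 * dotv w u) + t ^+ 2 * dotv u u.
    by rewrite -addrA.
  have dp : is_derive (0 : R) 1 p (2 * dotv w u).
    have H := is_deriveD (is_derive_cst (dotv w w) (0 : R) (1 : R))
      (is_deriveD (is_deriveM (is_derive_id (0 : R) (1 : R))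
         (is_derive_cst (2 * dotv w u) (0 : R) (1 : R)))
       (is_deriveM (is_deriveX 2 (is_derive_id (0 : R) (1 : R)))
         (is_derive_cst (dotv u u) (0 : R) (1 : R)))).
    apply: is_derive_eq H _; rewrite /= !scaler0 !add0r.
    by rewrite /GRing.scale /= expr1 !mulr0 mul0r mulr0 addr0 mulr1.
  have -> : g = @Num.sqrt R \o p by apply/funext => t /=; rewrite pE.
  have p0 : 0 < p 0 by rewrite pE.
  apply: is_derive_eq (is_derive1_comp (is_derive1_sqrt p0) dp) _.
  rewrite pE expr0n /= !mul0r !addr0 -/(enorm w).
  by field; rewrite enorm_eq0.
have E : (fun h : R => h^-1 *: ((@enorm R n \o shift w) (h *: u) - enorm w))
  = (fun h : R => h^-1 *: ((g \o shift 0) (h *: (1 : R)) - g 0)).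
  apply/funext => h /=; congr (_ *: (_ - _)).
    rewrite /enorm /g /= addr0 [h *: (1 : R)]mulr1; congr Num.sqrt.
    by rewrite !(dotvDl, dotvDr, dotvZl, dotvZr) (dotvC u w); ring.
  by rewrite /g /enorm !mul0r expr0n /= mul0r !addr0.
apply: DeriveDef.
  by rewrite /derivable E; exact: (@ex_derive _ _ _ _ _ _ _ dg).
by rewrite /derive E; exact: (@derive_val _ _ _ _ _ _ _ dg).
Qed.

End EuclideanGeometry.

(** * The standard simplex: compactness, and continuity of the maps used on it *)

Section Simplex.
Context {R : realType}.

Lemma lincomb_continuous m p (u : 'I_m -> 'rV[R]_p) :
  continuous (fun xi : 'rV[R]_m => \sum_(i < m) xi 0 i *: u i).
Proof.
apply: continuous_big => [|i _]; first exact: add_continuous.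
by move=> xi; exact: (cvgZr_tmp (@coord_continuous R 1 m 0 i xi)).
Qed.

Lemma dotv_continuousl m (W : 'rV[R]_m) : continuous (fun xi => dotv xi W).
Proof.
apply: continuous_big => [|i _]; first exact: add_continuous.
by move=> xi; exact: (cvgMr_tmp (@coord_continuous R 1 m 0 i xi)).
Qed.

Lemma enorm_continuous p : continuous (@enorm R p).
Proof.
move=> w; apply: continuous_comp; last exact: sqrt_continuous.
move: w; apply: continuous_big => [|i _]; first exact: add_continuous.
move=> w; have cw := @coord_continuous R 1 p 0 i w.
exact: (cvgM cw cw).
Qed.

(** A closed hyperplane section of a unit cube; the upper bounds on the coordinates come from
    nonnegativity and total weight one. *)
Lemma Xi_compact m : compact (@Xi R m).
Proof.
have -> : @Xi R m = [set v : 'rV[R]_m | forall i, `[0, 1]%classic (v ord0 i)] `&`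
    ((fun v : 'rV[R]_m => \sum_(i < m) v 0 i) @^-1` [set x | x = 1]).
  apply/seteqP; split => [xi [xi0 xi1]|xi /= [xi01 xi1]].
    split => //= i; rewrite in_itv/= xi0/= -xi1 (bigD1 i)//= lerDl.
    by apply: sumr_ge0.
  by split=> // j; have := xi01 j; rewrite /= in_itv/= => /andP[].
apply: compact_closedI.
  apply: (@rV_compact R m (fun=> `[0, 1]%classic)) => i.
  exact: segment_compact.
apply: preimage_closed; last exact: closed_eq.
move=> v _; move: v; apply: continuous_big => [|i _].
  exact: add_continuous.
exact: (@coord_continuous R).
Qed.

Lemma Xi_delta m (j : 'I_m) : Xi (delta_mx 0 j : 'rV[R]_m).
Proof.
split=> [i|]; first by rewrite mxE ler0n.
rewrite (bigD1 j)//= big1 => [|i /negPf ij]; first by rewrite mxE !eqxx addr0.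
by rewrite mxE ij andbF.
Qed.

Lemma convex_comb_le m (xi : 'rV[R]_m) (a : 'I_m -> R) M :
  Xi xi -> (forall j, a j <= M) -> \sum_(j < m) xi 0 j * a j <= M.
Proof.
move=> [xi0 xi1] aM; rewrite -[leRHS]mul1r -xi1 mulr_suml.
by apply: ler_sum => j _; rewrite ler_wpM2l.
Qed.

End Simplex.

(** * Minimizers for a homogeneous cost whose increments are bounded below *)

Section CausalCost.
Context {R : realType} {n : nat}.
Variables (C : 'rV[R]_n -> R) (delta : R).
Hypothesis C_homogeneous : forall (t : R) (xi : 'rV[R]_n),
  0 <= t -> C (t *: xi) = t * C xi.
(** Integrated form of the bound on the partial derivatives; it makes sense also at the origin,
    where a norm is not differentiable. *)
Hypothesis C_increment : forall (xi : 'rV[R]_n) j (t : R),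
  (forall i, 0 <= xi 0 i) -> 0 <= t ->
  C xi + t * delta <= C (xi + t *: delta_mx 0 j).
Implicit Types W xi eta : 'rV[R]_n.

(** Build [xi] from 0 one coordinate at a time: homogeneity gives [C 0 = 0], and the j-th increment
    adds at least [xi 0 j * delta]. *)
Lemma cost_ge xi : (forall i, 0 <= xi 0 i) ->
  delta * (\sum_(j < n) xi 0 j) <= C xi.
Proof.
move=> xi0; rewrite [in leRHS](row_sum_delta xi).
elim: (index_enum _) => [|j s IH].
  by rewrite !big_nil -[0 in leRHS](scale0r 0) C_homogeneous// mul0r mulr0.
rewrite !big_cons mulrDr addrC [in leRHS]addrC [delta * _ 0 _]mulrC.
apply: le_trans (C_increment _ _ (xi0 j)); first by rewrite lerD2r.
by move=> i; rewrite summxE sumr_ge0// => k _; rewrite !mxE mulr_ge0.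
Qed.

Lemma mode_objective_hom W t xi : 0 <= t ->
  mode_objective C W (t *: xi) = t * mode_objective C W xi.
Proof. by move=> t0; rewrite /mode_objective C_homogeneous// dotvZl mulrDr. Qed.

(** Normalizing [eta] to total weight one extends minimality from [Xi] to the cone; for [eta = 0],
    which cannot be normalized, both sides vanish. *)
Lemma mode_minimizer_cone W xi eta : mode_minimizer C W xi ->
  (forall j, 0 <= eta 0 j) ->
  (\sum_(j < n) eta 0 j) * mode_objective C W xi <= mode_objective C W eta.
Proof.
move=> [Xxi xi_min] eta0; set s := \sum_(j < n) _.
have s0 : 0 <= s by apply: sumr_ge0.
have [s_eq0|s_neq0] := eqVneq s 0.
  have -> : eta = 0 *: 0.
    apply/rowP => j; rewrite scale0r mxE.
    exact: (psumr_eq0P (fun i _ => eta0 i) s_eq0).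
  by rewrite s_eq0 mode_objective_hom// !mul0r.
have s_gt0 : 0 < s by rewrite lt0r s_neq0.
rewrite -ler_pdivlMl// -mode_objective_hom ?invr_ge0//; apply: xi_min.
split=> [j|]; first by rewrite mxE mulr_ge0 ?invr_ge0.
under eq_bigr do rewrite mxE.
by rewrite -mulr_sumr mulVf.
Qed.

(* Compare the minimizer with the result of deleting its j-th component. *)
Lemma mode_minimizer_causal W xi j : mode_minimizer C W xi -> 0 < xi 0 j ->
  W 0 j + delta <= mode_objective C W xi.
Proof.
move=> xi_min xij; have [[xi0 xi1] _] := xi_min.
pose eta := xi - xi 0 j *: delta_mx 0 j.
have etaE i : eta 0 i = if i == j then 0 else xi 0 i.
  rewrite !mxE eqxx /=; case: eqVneq => [->|_]; first by rewrite mulr1 subrr.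
  by rewrite mulr0 subr0.
have eta0 i : 0 <= eta 0 i by rewrite etaE; case: eqP.
have eta1 : \sum_(i < n) eta 0 i = 1 - xi 0 j.
  rewrite -xi1 [in RHS](bigD1 j)//= addrC addrK (bigD1 j)//= etaE eqxx add0r.
  by apply: eq_bigr => i /negPf ij; rewrite etaE ij.
have := mode_minimizer_cone xi_min eta0; rewrite eta1.
have := C_increment j eta0 (ltW xij); rewrite subrK.
have : dotv xi W = dotv eta W + xi 0 j * W 0 j.
  rewrite /dotv (bigD1 j)//= [in RHS](bigD1 j)//= etaE eqxx mul0r add0r addrC.
  by congr (_ + _); apply: eq_bigr => i /negPf ij; rewrite etaE ij.
(* Together the three relations give [xi 0 j * (W 0 j + delta) <= xi 0 j * mode_objective C W xi],
   and the positive factor cancels. *)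
rewrite /mode_objective => E1 E2 E3; rewrite -(ler_pM2l xij); lra.
Qed.

Lemma mode_value_minimizer W xi : mode_minimizer C W xi ->
  mode_value C W = mode_objective C W xi.
Proof.
move=> [Xxi xi_min]; apply/eqP; rewrite eq_le; apply/andP; split.
  apply: ge_inf; last by exists xi.
  by exists (mode_objective C W xi) => _ [eta Xeta <-]; exact: xi_min.
apply: lb_le_inf; first by exists (mode_objective C W xi), xi.
by move=> _ [eta Xeta <-]; exact: xi_min.
Qed.

Lemma absolutely_causal_of_increment : 0 < delta -> absolutely_causal C.
Proof.
move=> delta0 W _ xi xi_min j xij.
rewrite (mode_value_minimizer xi_min).
apply: lt_le_trans (mode_minimizer_causal xi_min xij).
by rewrite ltrDl.
Qed.

Lemma mode_minimizer_exists W : (0 < n)%N -> continuous C ->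
  exists xi, mode_minimizer C W xi.
Proof.
move=> n0 Ccont.
have [|||xi /set_mem Xxi xi_min] := @EVT_min_rV R n (mode_objective C W) Xi.
- by exists (delta_mx 0 (Ordinal n0)); exact: Xi_delta.
- exact: Xi_compact.
- apply: continuous_subspaceT => xi.
  exact: (cvgD (Ccont xi) (@dotv_continuousl R n W xi)).
- by exists xi; split=> // eta Xeta; apply: xi_min; rewrite inE.
Qed.

End CausalCost.

(** Serves as a nonnegative uniform bound in place of a maximum, with no case distinction on whether
    [V] is empty. *)
Lemma le_sum_norm {R : realType} {V : finType} (g : V -> R) x :
  g x <= \sum_(y : V) `|g y|.
Proof.
rewrite (bigD1 x)//=; apply: le_trans (ler_norm _) _.
by rewrite lerDl sumr_ge0.
Qed.

(** * Finite solutions of the discretized system by Perron's method *)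

Section BellmanEquation.
Context {R : realType} {n : nat} {V : finType}.
Variables (Omega : set 'rV[R]_n) (pos : V -> 'rV[R]_n) (mesh : {set {set V}}).
Variables (f q : 'rV[R]_n -> R).
Implicit Types (W w : V -> R) (x y : V) (S : {set V}) (xi : 'rV[R]_n).

Definition step_value w x S xi : R :=
  mode_cost pos f x S xi + \sum_(j < n) xi 0 j * w (mode_vertex x S j).

Definition finite_solution W : Prop := forall x,
  if pos x \in Omega then
    (exists S xi, [/\ S \in modes mesh x, Xi xi & W x = step_value W x S xi])
    /\ forall S xi, S \in modes mesh x -> Xi xi -> W x <= step_value W x S xi
  else W x = q (pos x).

(** Nonnegativity is included so that the values of all supersolutions at a vertex are bounded below
    and have an infimum. *)
Definition supersolution w : Prop := forall x,
  0 <= w x /\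
  if pos x \in Omega then
    exists S xi, [/\ S \in modes mesh x, Xi xi & step_value w x S xi <= w x]
  else q (pos x) <= w x.

Lemma step_value_objective w x S xi : step_value w x S xi =
  mode_objective (mode_cost pos f x S) (\row_j w (mode_vertex x S j)) xi.
Proof.
rewrite /step_value /mode_objective; congr (_ + _).
by apply: eq_bigr => j _; rewrite mxE.
Qed.

Lemma one_step_EFin W x S xi :
  one_step pos f (fun y => (W y)%:E) x S xi = (step_value W x S xi)%:E.
Proof.
by rewrite /one_step /step_value EFinD -sumEFin.
Qed.

Lemma step_value_delta w x S j : step_value w x S (delta_mx 0 j) =
  mode_cost pos f x S (delta_mx 0 j) + w (mode_vertex x S j).
Proof.
rewrite /step_value (bigD1 j)//= big1 => [|i /negPf ij].
  by rewrite mxE !eqxx mul1r addr0.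
by rewrite mxE ij andbF mul0r.
Qed.

Lemma le_step_value w w' x S xi : (forall y, w y <= w' y) -> Xi xi ->
  step_value w x S xi <= step_value w' x S xi.
Proof.
by move=> ww' [xi0 _]; rewrite lerD2l ler_sum// => j _; rewrite ler_wpM2l.
Qed.

Lemma finite_solution_discretization W : finite_solution W ->
  solves_discretization Omega pos mesh f q (fun x => (W x)%:E).
Proof.
move=> WP x; have := WP x; case: ifP => [xO [[S [xi [Sx Xxi E]]] Wmin]|_ ->//].
split.
  by exists S, xi; split=> //; rewrite one_step_EFin -E.
by move=> _ [S' [xi' [S'x Xxi' ->]]]; rewrite one_step_EFin lee_fin Wmin.
Qed.

Hypothesis n_gt0 : (0 < n)%N.
Hypothesis cost_continuous : forall x S, continuous (mode_cost pos f x S).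
Variable phi : V -> R.
(** As [V] is finite, following [phi] upwards leads from any interior vertex to the boundary. In
    particular every interior vertex has a mode. *)
Hypothesis phi_increases : forall x, pos x \in Omega ->
  exists S (j : 'I_n), S \in modes mesh x /\ phi x < phi (mode_vertex x S j).
Hypothesis q_ge0 : forall x, pos x \notin Omega -> 0 <= q (pos x).
Hypothesis cost_ge0 : forall x S xi,
  pos x \in Omega -> S \in modes mesh x -> Xi xi -> 0 <= mode_cost pos f x S xi.

(** Compactness of [Xi] gives a minimizer within each mode; the finitely many modes are then
    compared. *)
Lemma step_value_min w x : pos x \in Omega ->
  exists S xi, [/\ S \in modes mesh x, Xi xi &
    forall S' xi', S' \in modes mesh x -> Xi xi' ->
      step_value w x S xi <= step_value w x S' xi'].
Proof.
move=> /phi_increases[S0 [_ [S0x _]]].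
have /choice[xi_ xi_min] : forall S, exists xi, mode_minimizer
    (mode_cost pos f x S) (\row_j w (mode_vertex x S j)) xi.
  by move=> S; exact: mode_minimizer_exists.
case: (@arg_minP _ _ _ S0 (fun S => S \in modes mesh x)
  (fun S => step_value w x S (xi_ S)) S0x) => S Sx Smin.
exists S, (xi_ S); split=> //; first exact: (xi_min S).1.
move=> S' xi' S'x Xxi'; apply: le_trans (Smin _ S'x) _.
by rewrite !step_value_objective; exact: (xi_min S').2.
Qed.

(* Moving deterministically along increasing phi gives an affine function of
   phi as supersolution. *)
Lemma supersolution_exists : exists w, supersolution w.
Proof.
(* [k x] is the cost of one deterministic step divided by its gain in [phi], that is, the slope at
   which a drop in [- phi] pays for the step. *)
have /choice[k kP] : forall x, exists k, pos x \in Omega ->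
    exists S (j : 'I_n), [/\ S \in modes mesh x, phi x < phi (mode_vertex x S j) &
      mode_cost pos f x S (delta_mx 0 j) <=
        k * (phi (mode_vertex x S j) - phi x)].
  move=> x; have [/phi_increases[S [j [Sx lt]]]|] := boolP (pos x \in Omega).
    exists (mode_cost pos f x S (delta_mx 0 j) /
      (phi (mode_vertex x S j) - phi x)) => _; exists S, j; split=> //.
    by rewrite divfK// subr_eq0 gt_eqF.
  by exists 0.
(* [K] dominates all these slopes, [B] all values of [phi], and [Q] all boundary penalties. *)
pose K := \sum_x `|k x|; pose B := \sum_x `|phi x|.
pose Q := \sum_x `|q (pos x)|.
have K0 : 0 <= K by apply: sumr_ge0.
have Bphi x : 0 <= B - phi x by rewrite subr_ge0 le_sum_norm.
exists (fun x => K * (B - phi x) + Q) => x; split.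
  by rewrite addr_ge0 ?mulr_ge0 ?sumr_ge0.
case: ifPn => [/kP[S [j [Sx lt le]]]|_]; last first.
  apply: le_trans (_ : Q <= _); last by rewrite lerDr mulr_ge0.
  exact: (le_sum_norm (fun y => q (pos y))).
exists S, (delta_mx 0 j); split=> //; first exact: Xi_delta.
rewrite step_value_delta addrA lerD2r -lerBrDr -mulrBr.
have -> : B - phi x - (B - phi (mode_vertex x S j)) =
  phi (mode_vertex x S j) - phi x by ring.
apply: le_trans le _; rewrite ler_wpM2r ?subr_ge0 ?(ltW lt)//.
exact: le_sum_norm.
Qed.

(* Perron's method: the solution is the least supersolution; if it failed the
   equation at x, lowering its value there would give a smaller one. *)
Lemma finite_solution_exists : exists2 W, (forall x, 0 <= W x) & finite_solution W.
Proof.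
have [w0 w0P] := supersolution_exists.
pose values x : set R := [set w x | w in supersolution].
pose W x := inf (values x).
have values_lb x : has_lbound (values x).
  by exists 0 => _ [w wP <-]; exact: (wP x).1.
have values_ne x : values x !=set0 by exists (w0 x), w0.
have W_le w : supersolution w -> forall x, W x <= w x.
  by move=> wP x; apply: ge_inf => //; exists w.
have W_ge x c : (forall w, supersolution w -> c <= w x) -> c <= W x.
  by move=> H; apply: lb_le_inf => // _ [w wP <-]; exact: H.
have W0 x : 0 <= W x by apply: W_ge => w wP; exact: (wP x).1.
(* Replacing [W x] by a smaller [c] only lowers step values, so the modified function is still a
   supersolution and minimality forces [W x <= c]. *)
have lower x c : 0 <= c -> c <= W x ->
    (if pos x \in Omega then exists S xi,
       [/\ S \in modes mesh x, Xi xi & step_value W x S xi <= c]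
     else q (pos x) <= c) ->
    (forall y, y != x -> if pos y \in Omega then exists S xi,
       [/\ S \in modes mesh y, Xi xi & step_value W y S xi <= W y]
     else q (pos y) <= W y) -> W x = c.
  move=> c0 cW cP WP; apply/eqP; rewrite eq_le cW andbT.
  pose w y := if y == x then c else W y.
  have wW y : w y <= W y by rewrite /w; case: eqP => [->|].
  have wx : w x = c by rewrite /w eqxx.
  rewrite -wx; apply: W_le => y; split; first by rewrite /w; case: ifP.
  have [->|yx] := eqVneq y x.
    rewrite wx; move: cP; case: ifP => // _ [S [xi [Sx Xxi le]]].
    by exists S, xi; split=> //; apply: le_trans le; exact: le_step_value.
  have -> : w y = W y by rewrite /w (negPf yx).
  move: (WP y yx); case: ifP => // _ [S [xi [Sx Xxi le]]].
  by exists S, xi; split=> //; apply: le_trans le; exact: le_step_value.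
(* [W] is itself a supersolution: its best step at [y] is at most the corresponding step of every
   supersolution, hence at most the infimum. *)
have WP y : if pos y \in Omega then exists S xi,
       [/\ S \in modes mesh y, Xi xi & step_value W y S xi <= W y]
     else q (pos y) <= W y.
  case: ifPn => [yO|yO]; last first.
    by apply: W_ge => w /(_ y)[_]; rewrite (negPf yO).
  have [S [xi [Sy Xxi Smin]]] := step_value_min W yO.
  exists S, xi; split=> //; apply: W_ge => w wP.
  have [_] := wP y; rewrite yO => -[S' [xi' [S'y Xxi' le]]].
  apply: le_trans (Smin _ _ S'y Xxi') _; apply: le_trans le.
  by apply: le_step_value => //; exact: W_le.
exists W => // x; case: ifPn => [xO|xO]; last first.
  apply: lower => //; first exact: q_ge0.
  - by have := WP x; rewrite (negPf xO).
  - by rewrite (negPf xO).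
  - by move=> y _; exact: WP.
have [S [xi [Sx Xxi Smin]]] := step_value_min W xO.
have E : W x = step_value W x S xi.
  apply: lower.
  - rewrite addr_ge0 ?cost_ge0// sumr_ge0// => j _.
    by rewrite mulr_ge0//; case: Xxi.
  - have := WP x; rewrite xO => -[S' [xi' [S'x Xxi' le]]].
    exact: le_trans (Smin _ _ S'x Xxi') le.
  - by rewrite xO; exists S, xi.
  - by move=> y _; exact: WP.
by split; [exists S, xi|move=> S' xi' S'x Xxi'; rewrite E; exact: Smin].
Qed.

End BellmanEquation.

(** * The controlled Markov chain, and equality of its value function with [W] *)

Section ValueFunction.
Context {R : realType} {n : nat} {V : finType}.
Variables (Omega : set 'rV[R]_n) (pos : V -> 'rV[R]_n) (mesh : {set {set V}}).
Variables (f q : 'rV[R]_n -> R).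
Implicit Types (mu : V -> @control R n V) (pi : nat -> V -> @control R n V).
Implicit Types (phi : option V -> R) (s : option V) (x : V) (k : nat).

Definition expectation pi s k phi : R :=
  \sum_(s' : option V) state_law Omega pos pi s k s' * phi s'.

Definition next_mean mu phi s : R :=
  \sum_(s' : option V) transition Omega pos mu s s' * phi s'.

Definition extend (W : V -> R) s : R := if s is Some x then W x else 0.

Lemma sum_indicator s phi : \sum_(s' : option V) (s' == s)%:R * phi s' = phi s.
Proof.
rewrite (bigD1 s)//= eqxx mul1r big1 ?addr0// => s' /negPf ->.
by rewrite mul0r.
Qed.

Lemma next_meanE mu phi s : next_mean mu phi s =
  if s is Some x then
    if pos x \in Omega then
      \sum_(j < n) (mu x).2 0 j * phi (Some (mode_vertex x (mu x).1 j))
    else phi None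
  else phi None.
Proof.
rewrite /next_mean; case: s => [x|]; last exact: sum_indicator.
rewrite /=; case: ifP => _; last exact: sum_indicator.
under eq_bigr do rewrite mulr_suml.
rewrite exchange_big /=; apply: eq_bigr => j _.
under eq_bigr do rewrite -mulrA.
by rewrite -mulr_sumr sum_indicator.
Qed.

Lemma transition_ge0 mu s s' : control_mapping Omega pos mesh mu ->
  0 <= transition Omega pos mu s s'.
Proof.
case: s => [x|] muP /=; last exact: ler0n.
case: ifP => [/muP[_ [xi0 _]]|_]; last exact: ler0n.
by apply: sumr_ge0 => j _; rewrite mulr_ge0 ?ler0n.
Qed.

Lemma expectation0 pi s phi : expectation pi s 0 phi = phi s.
Proof. exact: sum_indicator. Qed.

(** Markov property: condition on the state at time [k] by exchanging the two sums. *)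
Lemma expectationS pi s k phi :
  expectation pi s k.+1 phi = expectation pi s k (next_mean (pi k) phi).
Proof.
rewrite /expectation /=; under eq_bigr do rewrite mulr_suml.
rewrite exchange_big /=; apply: eq_bigr => s'' _.
by rewrite mulr_sumr; apply: eq_bigr => s' _; rewrite mulrA.
Qed.

Lemma expectationD pi s k phi psi :
  expectation pi s k (fun s' => phi s' + psi s') =
  expectation pi s k phi + expectation pi s k psi.
Proof. by rewrite -big_split; apply: eq_bigr => s' _; rewrite mulrDr. Qed.

Lemma expectationZ pi s k c phi :
  expectation pi s k (fun s' => c * phi s') = c * expectation pi s k phi.
Proof. by rewrite mulr_sumr; apply: eq_bigr => s' _; rewrite mulrCA. Qed.

Lemma state_law_ge0 pi s k s' : policy Omega pos mesh pi ->
  0 <= state_law Omega pos pi s k s'.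
Proof.
move=> piP; elim: k s' => [|k IH] s' /=; first exact: ler0n.
by apply: sumr_ge0 => s'' _; rewrite mulr_ge0// transition_ge0.
Qed.

Lemma le_expectation pi s k phi psi : policy Omega pos mesh pi ->
  (forall s', phi s' <= psi s') ->
  expectation pi s k phi <= expectation pi s k psi.
Proof.
by move=> piP H; apply: ler_sum => s' _; rewrite ler_wpM2l// state_law_ge0.
Qed.

Variables (W : V -> R) (delta : R).
Hypothesis delta_gt0 : 0 < delta.
Hypothesis cost_ge_delta : forall x S xi,
  pos x \in Omega -> S \in modes mesh x -> Xi xi ->
  delta <= mode_cost pos f x S xi.
Hypothesis q_ge0 : forall x, pos x \notin Omega -> 0 <= q (pos x).
Hypothesis W_ge0 : forall x, 0 <= W x.
Hypothesis W_sol : finite_solution Omega pos mesh f q W.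

Local Notation stage mu := (stage_cost Omega pos f q mu).

Lemma stage_cost_ge0 mu s : control_mapping Omega pos mesh mu -> 0 <= stage mu s.
Proof.
move=> muP; case: s => [x|]//=; case: ifPn => [xO|]; last exact: q_ge0.
have [Sx Xxi] := muP x xO.
by apply: le_trans (cost_ge_delta xO Sx Xxi); exact: ltW.
Qed.

Lemma bellman_le mu s : control_mapping Omega pos mesh mu ->
  extend W s <= stage mu s + next_mean mu (extend W) s.
Proof.
move=> muP; rewrite next_meanE; case: s => [x|] /=; last by rewrite addr0.
have := W_sol x; case: ifP => [xO [_ Wmin]|_ ->]; last by rewrite addr0.
by have [Sx Xxi] := muP x xO; exact: Wmin.
Qed.

Lemma bellman_eq : exists2 mu, control_mapping Omega pos mesh mu &
  forall s, extend W s = stage mu s + next_mean mu (extend W) s.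
Proof.
have /choice[mu muP] : forall x, exists c : @control R n V, pos x \in Omega ->
    [/\ c.1 \in modes mesh x, Xi c.2 & W x = step_value pos f W x c.1 c.2].
  move=> x; have := W_sol x; case: ifP => [_ [[S [xi H]] _]|_ _].
    by exists (S, xi).
  (* An arbitrary control off [Omega], where the transition ignores it. *)
  by exists (finset.set0, 0).
exists mu => [x xO|s]; first by have [] := muP x xO.
rewrite next_meanE; case: s => [x|] /=; last by rewrite addr0.
have := W_sol x; case: ifP => [xO _|_ ->]; last by rewrite addr0.
by have [_ _] := muP x xO.
Qed.

(* Outside the target the expected value of W at the next state is paid for by
   the current stage cost, since a boundary state moves to the target. *)
Lemma next_mean_le_cost mu s M : control_mapping Omega pos mesh mu ->
  0 <= M -> (forall x, W x <= M) ->
  next_mean mu (extend W) s <= M / delta * stage mu s.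
Proof.
move=> muP M0 WM; rewrite next_meanE; case: s => [x|] /=; last by rewrite mulr0.
case: ifPn => [xO|xO]; last first.
  by rewrite mulr_ge0 ?q_ge0// divr_ge0// ltW.
have [Sx Xxi] := muP x xO.
apply: (@le_trans _ _ M); first exact: convex_comb_le.
rewrite mulrAC ler_pdivlMr// ler_wpM2l//.
exact: cost_ge_delta.
Qed.

Lemma expected_costE pi s : expected_cost Omega pos f q pi s =
  (\sum_(0 <= k <oo) (expectation pi s k (stage (pi k)))%:E)%E.
Proof. by []. Qed.

Lemma expectation_stage_ge0 pi s k : policy Omega pos mesh pi ->
  0 <= expectation pi s k (stage (pi k)).
Proof.
move=> piP; apply: sumr_ge0 => s' _.
by rewrite mulr_ge0 ?stage_cost_ge0 ?state_law_ge0.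
Qed.

Lemma partial_cost_lower pi x k : policy Omega pos mesh pi ->
  W x <= \sum_(0 <= i < k) expectation pi (Some x) i (stage (pi i))
         + expectation pi (Some x) k (extend W).
Proof.
move=> piP; elim: k => [|k IH]; first by rewrite big_nil add0r expectation0.
rewrite big_nat_recr//= expectationS -addrA -expectationD.
apply: le_trans IH _; rewrite lerD2l; apply: le_expectation => // s.
exact: bellman_le.
Qed.

(** If the cost were a finite [r < W x], then [partial_cost_lower] at [k.+1] and [next_mean_le_cost]
    would give [W x <= r + M / delta * c k]. Every stage would then cost at least the fixed [a > 0],
    and the partial sums would exceed [r]. *)
Lemma expected_cost_lower pi x : policy Omega pos mesh pi ->
  ((W x)%:E <= expected_cost Omega pos f q pi (Some x))%E.
Proof.
move=> piP; rewrite expected_costE.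
set c := fun k => expectation pi (Some x) k (stage (pi k)).
have c0 k : 0 <= c k by exact: expectation_stage_ge0.
have part k : ((\sum_(0 <= i < k) c i)%:E <= \sum_(0 <= k <oo) (c k)%:E)%E.
  rewrite -sumEFin; apply: nneseries_lim_ge => i _ _.
  by rewrite lee_fin.
rewrite leNgt; apply/negP => lt.
have e0 : (0%:E <= \sum_(0 <= k <oo) (c k)%:E)%E.
  by apply: nneseries_ge0 => i _ _; rewrite lee_fin.
move: part lt e0; case: (X in (_ <= X)%E) => // r part; rewrite lte_fin => lt _.
(* The summand 1 keeps [M] positive even when [W] vanishes identically. *)
pose M := \sum_y `|W y| + 1.
have M0 : 0 < M by rewrite ltr_wpDl// sumr_ge0.
have WM y : W y <= M by rewrite (le_trans (le_sum_norm W y))// lerDl.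
pose a := (W x - r) * delta / M.
have a0 : 0 < a by rewrite divr_gt0// mulr_gt0// subr_gt0.
have ca k : a <= c k.
  have := partial_cost_lower x k.+1 piP.
  rewrite expectationS => le1.
  have le2 : expectation pi (Some x) k (next_mean (pi k) (extend W)) <=
      M / delta * c k.
    rewrite /c -expectationZ; apply: le_expectation => // s.
    by apply: next_mean_le_cost => //; exact: ltW.
  have := part k.+1; rewrite lee_fin => le3.
  rewrite /a ler_pdivrMr// -ler_pdivlMr// mulrAC [c k * _]mulrC.
  by move: le1 le2 le3; rewrite -/c; lra.
have kr k : k%:R * a <= r.
  have := part k; rewrite lee_fin; apply: le_trans.
  elim: k => [|k IH]; first by rewrite big_nil mul0r.
  by rewrite big_nat_recr//= -natr1 mulrDl mul1r lerD.
have r0 : 0 <= r by have := kr 0%N; rewrite mul0r.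
have := truncnS_gt (r / a); rewrite ltr_pdivrMr// ltNge => /negP; apply.
exact: kr.
Qed.

(** For the greedy policy [bellman_eq] telescopes: [W x] is a partial cost plus the expected
    remaining [W], which is nonnegative. So every partial cost, and hence the limit, is at most
    [W x]. *)
Lemma value_finite_solution x :
  value Omega pos mesh f q (Some x) = (W x)%:E.
Proof.
apply/eqP; rewrite eq_le; apply/andP; split; last first.
  by apply: le_ereal_inf_tmp => _ [pi piP <-]; exact: expected_cost_lower.
have [mu muP muE] := bellman_eq.
have piP : policy Omega pos mesh (fun=> mu) by [].
apply: ge_ereal_inf; exists (expected_cost Omega pos f q (fun=> mu) (Some x)).
  by exists (fun=> mu).
rewrite expected_costE; apply: lime_le.
  by apply: is_cvg_nneseries => k _ _; rewrite lee_fin expectation_stage_ge0.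
apply: nearW => k; rewrite sumEFin lee_fin.
suff -> : W x = \sum_(0 <= i < k) expectation (fun=> mu) (Some x) i (stage mu)
         + expectation (fun=> mu) (Some x) k (extend W).
  rewrite lerDl; apply: sumr_ge0 => s _.
  by rewrite mulr_ge0 ?state_law_ge0//; case: s => /=.
elim: k => [|k IH]; first by rewrite big_nil add0r expectation0.
rewrite big_nat_recr//= expectationS -addrA -expectationD {}IH; congr (_ + _).
by apply: eq_bigr => s _; rewrite -muE.
Qed.

End ValueFunction.

(** * Correctness and termination of the two label-setting methods *)

Section LabelSetting.
Context {R : realType} {n : nat} {V : finType}.
Variables (Omega : set 'rV[R]_n) (pos : V -> 'rV[R]_n) (mesh : {set {set V}}).
Variables (f q : 'rV[R]_n -> R) (W : V -> R) (delta : R).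
Hypothesis delta_gt0 : 0 < delta.
Hypothesis W_ge0 : forall x, 0 <= W x.
Hypothesis W_sol : finite_solution Omega pos mesh f q W.
Hypothesis W_causal : forall x S xi j, pos x \in Omega -> S \in modes mesh x ->
  Xi xi -> W x = step_value pos f W x S xi -> 0 < xi 0 j ->
  W (mode_vertex x S j) + delta <= W x.
Implicit Types (P : {set V}) (s : @method_state R V) (x y : V) (S : {set V})
  (xi : 'rV[R]_n).

(** The upper bounds use [W] in place of the labels, with which it agrees on [P]; thus the invariant
    does not depend on the order in which vertices became permanent. *)
Definition invariant s : Prop := forall x,
  if x \in s.1 then s.2 x = (W x)%:E
  else if pos x \in Omega then
    ((W x)%:E <= s.2 x)%E /\
    forall S xi, S \in modes mesh x -> Xi xi -> supported s.1 x S xi ->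
      (s.2 x <= (step_value pos f W x S xi)%:E)%E
  else s.2 x = (W x)%:E.

(** Vertices off [P] have weight zero and contribute nothing, even with an infinite label, since
    [0 * +oo = 0]. *)
Lemma one_step_supported P (lab : V -> \bar R) x S xi :
  (forall y, y \in P -> lab y = (W y)%:E) -> supported P x S xi ->
  one_step pos f lab x S xi = (step_value pos f W x S xi)%:E.
Proof.
move=> labP sup; rewrite -one_step_EFin; congr (_ + _)%E.
apply: eq_bigr => j _; have [/labP ->//|/sup ->] := boolP (mode_vertex x S j \in P).
by rewrite !mul0e.
Qed.

Lemma invariant_permanent s x : invariant s -> x \in s.1 -> s.2 x = (W x)%:E.
Proof. by move=> /(_ x) + xs; rewrite xs. Qed.

Lemma invariant_ge s x : invariant s -> ((W x)%:E <= s.2 x)%E.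
Proof. by move=> /(_ x); case: ifP => [_ ->//|_]; case: ifP => [_ []//|_ ->]. Qed.

(** By causality an optimal step at [x] puts weight only on vertices with value at most
    [W x - delta]. These lie in [P], so the step is one of the supported candidates bounding the
    label from above. *)
Lemma label_exact s x : invariant s ->
  (forall y, W y + delta <= W x -> y \in s.1) -> s.2 x = (W x)%:E.
Proof.
move=> sI below; apply/eqP; rewrite eq_le invariant_ge// andbT.
have := sI x; case: ifP => [_ ->//|_].
case: ifP => [xO [_ cand]|_ ->//].
have := W_sol x; rewrite xO => -[[S [xi [Sx Xxi E]]] _].
rewrite [in leRHS]E; apply: cand => // j; apply: contraNeq => xij.
apply: below; apply: (W_causal xO Sx Xxi E).
by case: Xxi => xi0 _; rewrite lt0r xij xi0.
Qed.

Lemma min_tentative_label s y : invariant s -> y \notin s.1 ->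
  (forall z, z \notin s.1 -> W y <= W z) -> s.2 y = (W y)%:E.
Proof.
move=> sI ys ymin; apply: label_exact => // z; apply: contraTT => zs.
by rewrite -ltNge; apply: le_lt_trans (ymin z zs) _; rewrite ltrDl.
Qed.

Lemma min_tentative_exists s : s.1 <> [set: V]%SET ->
  exists2 y, y \notin s.1 & forall z, z \notin s.1 -> W y <= W z.
Proof.
move=> sT; have [x0 x0s] : exists x, x \notin s.1.
  apply: contrapT => /forallNP H; apply: sT; apply/setP => x; rewrite !inE.
  by have /negP := H x; rewrite negbK.
case: (@arg_minP _ _ _ x0 (fun x => x \notin s.1) W x0s) => y ys ymin.
by exists y.
Qed.

Lemma invariant_initial : invariant (initial_state Omega pos q).
Proof.
move=> x; rewrite /= inE; have := W_sol x; case: ifP => [_ _|_ ->//].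
split=> [|S xi _ [_ xi1] sup]; first exact: leey.
(* While [P] is empty no weight vector is supported: all weights would vanish, against their sum
   being 1. *)
suff : \sum_(j < n) xi 0 j = 0 by rewrite xi1 => /eqP; rewrite oner_eq0.
by apply: big1 => j _; apply: sup; rewrite inE.
Qed.

(** Induction on the number of tentative vertices. Preservation is asked of every possible step,
    which covers all ways of breaking ties. *)
Lemma ends_correctly_of_invariant
    (step : @method_state R V -> @method_state R V -> Prop) :
  (forall s, invariant s -> s.1 <> [set: V]%SET -> exists s', step s s') ->
  (forall s s', invariant s -> step s s' -> invariant s' /\ s.1 \proper s'.1) ->
  forall s, invariant s -> ends_correctly step (fun x => (W x)%:E) s.
Proof.
move=> progress preserve s.
have [m] := ubnP #|~: s.1|; elim: m s => // m IH s; rewrite ltnS => le_m sI.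
have [sT|sT] := pselect (s.1 = [set: V]%SET).
  by apply: ends_now => // x; rewrite invariant_permanent// sT inE.
apply: ends_later => //; first exact: progress.
move=> s' ss'; have [s'I lt] := preserve s s' sI ss'.
by apply: IH => //; apply: leq_trans le_m; rewrite proper_card// properC.
Qed.

Lemma dijkstra_applicable : ends_correctly (dijkstra_step Omega pos mesh f)
  (fun x => (W x)%:E) (initial_state Omega pos q).
Proof.
apply: ends_correctly_of_invariant invariant_initial => [s sI sT|s s' sI].
  have [y ys ymin] := min_tentative_exists sT.
  pose P := (y |: s.1)%SET.
  exists (P, fun x => if (x \notin P) && (pos x \in Omega)
      then Order.min (s.2 x)
             (ereal_inf (dijkstra_candidates pos mesh f P s.2 y x))
      else s.2 x).
  exists y; split=> // z zs; rewrite (min_tentative_label sI ys ymin).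
  by apply: le_trans (invariant_ge z sI); rewrite lee_fin ymin.
move=> [xbar [xs xmin s'1 s'2]]; split; last first.
  by rewrite s'1 properUr// finset.sub1set.
have [y ys ymin] : exists2 y, y \notin s.1 & forall z, z \notin s.1 -> W y <= W z.
  by apply: min_tentative_exists => sT; move: xs; rewrite sT inE.
(* The label of [xbar] is at most the exact label [W y] of a tentative vertex of least value, hence
   at most [W xbar]. *)
have xW : s.2 xbar = (W xbar)%:E.
  apply/eqP; rewrite eq_le invariant_ge// andbT.
  apply: le_trans (xmin y ys) _.
  by rewrite (min_tentative_label sI ys ymin) lee_fin ymin.
have labP z : z \in s'.1 -> s.2 z = (W z)%:E.
  by rewrite s'1 !inE => /orP[/eqP ->//|]; exact: invariant_permanent.
move=> x; rewrite s'2; case: (boolP (x \in s'.1)) => xs' /=; first exact: labP.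
have xns : x \notin s.1 by apply: contra xs'; rewrite s'1 !inE orbC => ->.
have := sI x; rewrite (negPf xns); case: ifP => [xO [Wx cand]|//].
split.
  rewrite le_min Wx /=; apply: le_ereal_inf_tmp => _ [S [xi [Sx Xxi sup _ ->]]].
  rewrite (one_step_supported labP sup) lee_fin.
  by have := W_sol x; rewrite xO => -[_]; apply.
move=> S xi Sx Xxi sup; rewrite ge_min.
(* A step supported on the new [P] either uses [xbar] and is a fresh candidate, or was already
   supported on the old [P] and bounds the old label. *)
have [[j jx xij]|H] := pselect (exists2 j, mode_vertex x S j = xbar & 0 < xi 0 j).
  apply/orP; right; apply: ereal_inf_lbound; exists S, xi; split=> //.
    by exists j.
  by rewrite (one_step_supported labP sup).
rewrite cand// => j js; have [jx|jx] := eqVneq (mode_vertex x S j) xbar.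
  apply/eqP; rewrite eq_le; apply/andP; split; last by case: Xxi.
  by rewrite leNgt; apply/negP => xij; apply: H; exists j.
by apply: sup; rewrite s'1 !inE negb_or jx.
Qed.

Lemma dial_applicable : ends_correctly (dial_step Omega pos mesh f delta)
  (fun x => (W x)%:E) (initial_state Omega pos q).
Proof.
have bucket_of y : exists k, k%:R * delta <= W y < k.+1%:R * delta.
  exists (Num.truncn (W y / delta)).
  have : 0 <= W y / delta by rewrite divr_ge0// ltW.
  by move/truncn_itv; rewrite ler_pdivlMr// ltr_pdivrMr.
apply: ends_correctly_of_invariant invariant_initial => [s sI sT|s s' sI].
  have [y ys ymin] := min_tentative_exists sT.
  have [k kP] := bucket_of y.
  pose P := [set x | (x \in s.1) || `[< in_bucket delta k s x >]]%SET.
  exists (P, fun x => if (x \notin P) && (pos x \in Omega)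
      then Order.min (s.2 x) (ereal_inf (dial_candidates pos mesh f P s.2 x))
      else s.2 x).
  exists k; split=> //.
  - exists y; split=> //; rewrite (min_tentative_label sI ys ymin).
    by rewrite lee_fin lte_fin.
  - move=> k' x k'k [xs /andP[_]]; apply/negP; rewrite -leNgt.
    apply: le_trans (invariant_ge x sI); rewrite lee_fin.
    apply: le_trans (ymin x xs); case/andP: kP => kP _; apply: le_trans kP.
    by rewrite ler_pM2r// ler_nat.
  - move=> x; rewrite /= inE; split.
      by case/orP => [|/asboolP]; [left|right].
    by case=> [->//|?]; apply/orP; right; apply/asboolP.
move=> [k [[x0 x0k] kmin s'1 s'2]].
(* A tentative vertex of least value carries its exact label, so a value below [k%:R * delta] would
   put it in an earlier nonempty bucket. *)
have kW z : z \notin s.1 -> k%:R * delta <= W z.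
  move=> zs; have [y ys ymin] : exists2 y, y \notin s.1 &
      forall z, z \notin s.1 -> W y <= W z.
    apply: min_tentative_exists => sT.
    by have [+ _] := x0k; rewrite sT inE.
  apply: le_trans (ymin z zs); have [k' k'P] := bucket_of y.
  apply: le_trans (_ : k'%:R * delta <= _); last by case/andP: k'P.
  rewrite ler_pM2r// ler_nat leqNgt; apply/negP => k'k; apply: (kmin k' y k'k).
  split=> //; rewrite (min_tentative_label sI ys ymin).
  by rewrite lee_fin lte_fin.
(* For [z] in the bucket, [W z < k.+1%:R * delta]. Any [y] with [W y + delta <= W z] then has
   [W y < k%:R * delta] and is already permanent: the width [delta] is exactly what is needed. *)
have labP z : z \in s'.1 -> s.2 z = (W z)%:E.
  move/s'1 => [|[zs /andP[_ zk]]]; first exact: invariant_permanent.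
  apply: label_exact => // y yz; apply: contraTT (yz) => /kW ky; rewrite -ltNge.
  have := le_lt_trans (invariant_ge z sI) zk; rewrite lte_fin.
  by rewrite -natr1 mulrDl mul1r; move: ky; lra.
have ss' z : z \in s.1 -> z \in s'.1 by move=> zs; apply/s'1; left.
split; last first.
  apply/properP; split; first exact/fintype.subsetP.
  by exists x0; [apply/s'1; right|case: x0k].
move=> x; rewrite s'2; case: (boolP (x \in s'.1)) => xs' /=; first exact: labP.
have xns : x \notin s.1 by apply: contra xs' => /ss'.
have := sI x; rewrite (negPf xns); case: ifP => [xO [Wx cand]|//].
split.
  rewrite le_min Wx /=; apply: le_ereal_inf_tmp => _ [S [xi [Sx Xxi sup ->]]].
  rewrite (one_step_supported labP sup) lee_fin.
  by have := W_sol x; rewrite xO => -[_]; apply.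
move=> S xi Sx Xxi sup; rewrite ge_min; apply/orP; right.
apply: ereal_inf_lbound; exists S, xi; split=> //.
by rewrite (one_step_supported labP sup).
Qed.

End LabelSetting.

(** * Closedness and coordinate bounds for simplices *)

Section SimplexHull.
Context {R : realType} {n : nat} {V : finType}.
Variable pos : V -> 'rV[R]_n.
Implicit Types (x v : V) (S T : {set V}).

Lemma simplex_hull_vertex S x : x \in S -> simplex_hull pos S (pos x).
Proof.
move=> xS; exists (fun v => (v == x)%:R); split=> [v||]; first exact: ler0n.
  rewrite (bigD1 x)//= eqxx big1 ?addr0// => v /andP[_ /negPf ->//].
rewrite (bigD1 x)//= eqxx scale1r big1 ?addr0// => v /andP[_ /negPf ->].
by rewrite scale0r.
Qed.

(** Indexing the weights by ordinals exhibits the hull as a continuous image of a compact standard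
    simplex. *)
Lemma simplex_hull_image S : simplex_hull pos S =
  [set \sum_(i < #|S|) xi 0 i *: pos (enum_val i) | xi in @Xi R #|S|].
Proof.
apply/seteqP; split=> [p [w [w0 w1 ->]]|p [xi [xi0 xi1] <-]].
  exists (\row_i w (enum_val i)); first split=> [j|].
  - by rewrite mxE.
  - by under eq_bigr do rewrite mxE; rewrite -(big_enum_val (A := mem S) w).
  - under eq_bigr do rewrite mxE.
    by rewrite -(big_enum_val (A := mem S) (fun v => w v *: pos v)).
pose w v := \sum_(i < #|S|) xi 0 i * (v == enum_val i)%:R.
have wE i : w (enum_val i) = xi 0 i.
  rewrite /w (bigD1 i)//= eqxx mulr1 big1 ?addr0// => k ki.
  by rewrite (inj_eq enum_val_inj) eq_sym (negPf ki) mulr0.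
exists w; split=> [v||].
- by apply: sumr_ge0 => i _; rewrite mulr_ge0// ler0n.
- by rewrite big_enum_val; apply: etrans xi1; apply: eq_bigr => i _; exact: wE.
- by rewrite [RHS]big_enum_val; apply: eq_bigr => i _; rewrite wE.
Qed.

Lemma simplex_hull_closed S : closed (simplex_hull pos S).
Proof.
rewrite simplex_hull_image; apply: compact_closed; first exact: norm_hausdorff.
apply: continuous_compact; last exact: Xi_compact.
exact/continuous_subspaceT/lincomb_continuous.
Qed.

Lemma simplex_hull_coord_le S p (i : 'I_n) c : simplex_hull pos S p ->
  (forall v, v \in S -> pos v 0 i <= c) -> p 0 i <= c.
Proof.
move=> [w [w0 w1 ->]] H; rewrite summxE -[leRHS]mul1r -w1 mulr_suml.
by apply: ler_sum => v vS; rewrite mxE ler_wpM2l// H.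
Qed.

End SimplexHull.

(** * Mesh geometry: stars of vertices, edge lengths and angles *)

Section MeshGeometry.
Context {R : realType} {n : nat} {V : finType}.
Hypothesis n_gt0 : (0 < n)%N.
Variables (Omega : set 'rV[R]_n) (pos : V -> 'rV[R]_n) (mesh : {set {set V}}).
Hypothesis Omega_open : open Omega.
Hypothesis mesh_tri : triangulation pos (closure Omega) mesh.
Implicit Types (x v : V) (S T : {set V}) (i j k : 'I_n).

(** [S] has [n.+1] elements, so removing [x] leaves exactly [n] and the default of [nth] is never
    reached. *)
Lemma mode_vertex_in x S j : S \in modes mesh x ->
  mode_vertex x S j \in (S :\ x)%SET.
Proof.
rewrite inE => /andP[Sm xS]; rewrite -mem_enum; apply: mem_nth.
have := cardsD1 x S; rewrite xS (tri_card mesh_tri Sm) add1n => -[/esym E].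
by rewrite -cardE E.
Qed.

Lemma mode_vertex_onto x S v : S \in modes mesh x -> v \in (S :\ x)%SET ->
  exists j, mode_vertex x S j = v.
Proof.
rewrite inE => /andP[Sm xS] vS.
have lt : (index v (enum (S :\ x)%SET) < n)%N.
  have := cardsD1 x S; rewrite xS (tri_card mesh_tri Sm) add1n => -[->].
  by rewrite cardE index_mem mem_enum.
by exists (Ordinal lt); rewrite /mode_vertex /= nth_index// mem_enum.
Qed.

Lemma mode_edge_neq0 x S j : S \in modes mesh x ->
  pos (mode_vertex x S j) - pos x != 0.
Proof.
move=> Sx; have := mode_vertex_in j Sx; rewrite !inE => /andP[+ _].
by rewrite subr_eq0 (inj_eq (tri_pos_inj mesh_tri)).
Qed.

Lemma pos_closure x : closure Omega (pos x).
Proof.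
rewrite -(tri_cover mesh_tri); have [S Sm xS] := tri_vertex mesh_tri x.
by exists S => //; exact: simplex_hull_vertex.
Qed.

(* By conformity x would be a convex combination of other vertices of a simplex
   containing x. *)
Lemma vertex_notin_simplex x T : T \in mesh -> x \notin T ->
  ~ simplex_hull pos T (pos x).
Proof.
move=> Tm xT xhT; have [S Sm xS] := tri_vertex mesh_tri x.
have : (simplex_hull pos S `&` simplex_hull pos T) (pos x).
  by split=> //; exact: simplex_hull_vertex.
rewrite (tri_conforming mesh_tri Sm Tm) => -[w [w0 w1 E]].
(* The weights of [x] in the common face, minus the indicator of [x]. Taking [F] to be [pos] and
   then the constant 1 gives an affine relation on [S] with coefficient -1 at [x], against
   nondegeneracy. *)
have restr (A : lmodType R) (F : V -> A) :
    \sum_(v in S) ((v \in T)%:R * w v - (v == x)%:R) *: F v =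
    \sum_(v in (S :&: T)%SET) w v *: F v - F x.
  under eq_bigr do rewrite scalerBl.
  rewrite sumrB; congr (_ - _); last first.
    rewrite (bigD1 x)//= eqxx scale1r big1 ?addr0// => v /andP[_ /negPf ->].
    by rewrite scale0r.
  rewrite [RHS](eq_bigl (fun v => (v \in S) && (v \in T))) => [|v]; last first.
    by rewrite inE.
  rewrite [RHS]big_mkcondr /=; apply: eq_bigr => v _.
  by case: (v \in T); rewrite ?mul1r// mul0r scale0r.
have := tri_nondegenerate mesh_tri Sm
  (w := fun v => (v \in T)%:R * w v - (v == x)%:R).
rewrite restr -E subrr => /(_ _ erefl x xS).
rewrite (negPf xT) eqxx mul0r sub0r => H.
suff /H/eqP : \sum_(v in S) ((v \in T)%:R * w v - (v == x)%:R) = 0.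
  by rewrite oppr_eq0 oner_eq0.
have := restr R^o (fun=> 1); rewrite /GRing.scale /=.
under eq_bigr do rewrite mulr1.
move=> ->; under eq_bigr do rewrite mulr1.
by rewrite w1 subrr.
Qed.

(* A short step from x in a coordinate direction stays in the star of x. *)
Lemma mode_vertex_coord_gt x i : pos x \in Omega ->
  exists S j, S \in modes mesh x /\ pos x 0 i < pos (mode_vertex x S j) 0 i.
Proof.
rewrite inE => xO; apply: contrapT => H.
have coord_le S v : S \in modes mesh x -> v \in S -> pos v 0 i <= pos x 0 i.
  move=> Sx vS; have [->//|vx] := eqVneq v x.
  have [|j <-] := mode_vertex_onto (v := v) Sx; first by rewrite !inE vx.
  by rewrite leNgt; apply/negP => lt; apply: H; exists S, j.
(* The simplices without [x] are finitely many closed sets avoiding [pos x], so a neighbourhood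
   avoids them all. *)
have near_star : \forall p \near pos x, forall T : {set V},
    T \in mesh -> x \notin T -> ~ simplex_hull pos T p.
  apply: (@filter_forall _ {set V} (fun T p =>
    T \in mesh -> x \notin T -> ~ simplex_hull pos T p) (nbhs (pos x)) _) => T.
  have [Tm|] := boolP (T \in mesh); last by move=> _; apply: nearW.
  have [xT|xT] := boolP (x \in T); first exact: nearW.
  suff : \forall p \near pos x, ~ simplex_hull pos T p.
    by apply: filterS => p.
  apply: open_nbhs_nbhs; split; last exact: vertex_notin_simplex.
  exact/closed_openC/simplex_hull_closed.
have near_Omega : \forall p \near pos x, Omega p.
  exact: open_nbhs_nbhs.
have line : (fun t : R => pos x + t *: (delta_mx 0 i : 'rV[R]_n)) @ (0 : R) -->
    pos x + 0 *: (delta_mx 0 i : 'rV[R]_n).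
  apply: cvgD; first exact: cvg_cst.
  exact: (cvgZr_tmp (@cvg_id _ (nbhs (0 : R)))).
rewrite scale0r addr0 in line.
have /nbhs_ballP[e /= e0 be] : \forall t \near (0 : R),
    (forall T : {set V}, T \in mesh -> x \notin T ->
       ~ simplex_hull pos T (pos x + t *: delta_mx 0 i)) /\
    Omega (pos x + t *: delta_mx 0 i).
  exact: line _ (filterI near_star near_Omega).
have [|star Omt] := be (e / 2).
  rewrite /ball /= sub0r normrN ger0_norm ?divr_ge0 ?(ltW e0)//.
  by rewrite ltr_pdivrMr// ltr_pMr// ltr1n.
have : closure Omega (pos x + (e / 2) *: delta_mx 0 i) by exact: subset_closure.
rewrite -(tri_cover mesh_tri) => -[S /= Sm hS].
(* The displaced point lies in a simplex of the star, where by assumption the i-th coordinate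
   nowhere exceeds that of [x]. *)
have [xS|xS] := boolP (x \in S); last exact: (star S Sm xS).
have Sx : S \in modes mesh x by rewrite inE Sm.
have := simplex_hull_coord_le hS (fun v => coord_le S v Sx).
rewrite !mxE !eqxx mulr1 gerDl leNgt => /negP; apply.
by rewrite divr_gt0.
Qed.

Lemma min_edge_le S u v : S \in mesh -> u \in S -> v \in S -> u != v ->
  min_edge pos mesh <= enorm (pos u - pos v).
Proof.
move=> Sm uS vS uv; apply: ge_inf; last by exists S, u, v.
by exists 0 => _ [? [? [? [_ _ _ _ ->]]]]; exact: enorm_ge0.
Qed.

Lemma min_edge_gt0 : Omega !=set0 -> 0 < min_edge pos mesh.
Proof.
move=> [p Op]; have : closure Omega p by exact: subset_closure.
rewrite -(tri_cover mesh_tri) => -[S /= Sm _].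
have [u [v [uS vS uv]]] : exists u v, [/\ u \in S, v \in S & u != v].
  have /card_gt1P : (1 < #|S|)%N by rewrite (tri_card mesh_tri Sm).
  by move=> [u [v [uS vS uv]]]; exists u, v.
(* [K] bounds the reciprocals of all edge lengths, so [K^-1] is a positive lower bound for the
   lengths. *)
pose g (e : V * V) := (enorm (pos e.1 - pos e.2))^-1.
pose K := 1 + \sum_e `|g e|.
have K0 : 0 < K by rewrite ltr_pwDl// sumr_ge0.
have : K^-1 <= min_edge pos mesh.
  apply: lb_le_inf; first by exists (enorm (pos u - pos v)), S, u, v.
  move=> _ [T [a [b [_ _ _ ab ->]]]].
  have ab0 : 0 < enorm (pos a - pos b).
    by rewrite enorm_gt0 subr_eq0 (inj_eq (tri_pos_inj mesh_tri)).
  rewrite -[leRHS]invrK lef_pV2 ?posrE ?invr_gt0//.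
  by apply: le_trans (le_sum_norm g (a, b)) _; rewrite lerDr.
by apply: lt_le_trans; rewrite invr_gt0.
Qed.

Lemma angle_le_max x S i k : pos x \in Omega -> S \in modes mesh x ->
  angle (pos (mode_vertex x S i) - pos x) (pos (mode_vertex x S k) - pos x)
  <= max_angle pos Omega mesh.
Proof.
move=> xO Sx; apply: ub_le_sup; last by exists x, S, i, k.
pose g (a : V * {set V} * ('I_n * 'I_n)) :=
  angle (pos (mode_vertex a.1.1 a.1.2 a.2.1) - pos a.1.1)
        (pos (mode_vertex a.1.1 a.1.2 a.2.2) - pos a.1.1).
exists (\sum_a `|g a|) => _ [y [T [i' [k' [_ _ ->]]]]].
exact: (le_sum_norm g (y, T, (i', k'))).
Qed.

(** An edge makes a nonnegative angle with itself; without interior vertices the supremum of the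
    empty set is 0. *)
Lemma max_angle_ge0 : 0 <= max_angle pos Omega mesh.
Proof.
have [[x xO]|H] := pselect (exists x, pos x \in Omega).
  have [S [j [Sx _]]] := mode_vertex_coord_gt (Ordinal n_gt0) xO.
  apply: le_trans (angle_le_max j j xO Sx).
  apply: acos_ge0; rewrite -sqr_enorm -expr2 divff ?lexx ?andbT; first lra.
  by rewrite expf_neq0// enorm_eq0 mode_edge_neq0.
rewrite /max_angle [X in sup X](_ : _ = set0) ?sup0//.
by apply/seteqP; split=> // a [x [_ [_ [_ [xO _ _]]]]]; apply: H; exists x.
Qed.

Lemma mode_edges_acute x S i k : pos x \in Omega -> S \in modes mesh x ->
  max_angle pos Omega mesh <= pi ->
  cos (max_angle pos Omega mesh) *
    (enorm (pos (mode_vertex x S i) - pos x) *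
     enorm (pos (mode_vertex x S k) - pos x)) <=
  dotv (pos (mode_vertex x S i) - pos x) (pos (mode_vertex x S k) - pos x).
Proof.
move=> xO Sx le_pi; apply: cos_bound_of_angle; try exact: mode_edge_neq0.
by rewrite angle_le_max.
Qed.

End MeshGeometry.

(** * The Eikonal cost: homogeneity, increments and partial derivatives *)

Section EikonalCost.
Context {R : realType} {n : nat} {V : finType}.
Variables (pos : V -> 'rV[R]_n) (f : 'rV[R]_n -> R).
Implicit Types (x : V) (S : {set V}) (xi : 'rV[R]_n) (t : R).

Local Notation edge x S := (fun i : 'I_n => pos (mode_vertex x S i) - pos x).

Lemma mode_cost_hom x S t xi : 0 <= t ->
  mode_cost pos f x S (t *: xi) = t * mode_cost pos f x S xi.
Proof.
move=> t0; rewrite /mode_cost mulrA -enormZ// scaler_sumr.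
by congr (enorm _ / _); apply: eq_bigr => i _; rewrite mxE scalerA.
Qed.

Lemma mode_cost_continuous x S : continuous (mode_cost pos f x S).
Proof.
have tau_continuous : continuous (tau pos x S).
  move=> xi; apply: (@continuous_comp _ _ _
    (fun xi : 'rV[R]_n => \sum_(i < n) xi 0 i *: edge x S i) (@enorm R n)).
    exact: lincomb_continuous.
  exact: enorm_continuous.
by move=> xi; exact: (cvgMr_tmp (tau_continuous xi)).
Qed.

Lemma lincomb_add_delta (u : 'I_n -> 'rV[R]_n) xi t j :
  \sum_(i < n) (xi + t *: delta_mx 0 j) 0 i *: u i =
  \sum_(i < n) xi 0 i *: u i + t *: u j.
Proof.
under eq_bigr do rewrite !mxE scalerDl.
rewrite big_split/=; congr (_ + _).
rewrite (bigD1 j)//= !eqxx mulr1 big1 ?addr0// => i /negPf ij.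
by rewrite ij mulr0 scale0r.
Qed.

(** The difference quotient of the cost in the j-th weight is that of the scaled norm along the j-th
    edge, at a nonzero point. *)
Lemma is_derive_mode_cost x S xi j :
  \sum_(i < n) xi 0 i *: edge x S i != 0 ->
  is_derive xi (delta_mx 0 j) (mode_cost pos f x S)
    (dotv (\sum_(i < n) xi 0 i *: edge x S i) (edge x S j) /
       tau pos x S xi / f (pos x)).
Proof.
set w := \sum_(i < n) _ => w0.
have dE := is_derive_enorm (edge x S j) w0.
have dC : is_derive w (edge x S j) ((f (pos x))^-1 \*: @enorm R n)
    ((f (pos x))^-1 *: (dotv w (edge x S j) / enorm w)) by exact: is_deriveZ.
have E : (fun t : R => t^-1 *:
      ((mode_cost pos f x S \o shift xi) (t *: delta_mx 0 j) -
      mode_cost pos f x S xi)) =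
    (fun t : R => t^-1 *:
      ((((f (pos x))^-1 \*: @enorm R n) \o shift w) (t *: edge x S j) -
      ((f (pos x))^-1 \*: @enorm R n) w)).
  apply/funext => t /=; congr (_ *: (_ - _)); last exact: mulrC.
  by rewrite /mode_cost /tau addrC lincomb_add_delta mulrC [in RHS]addrC.
apply: DeriveDef.
  by rewrite /derivable E; exact: (@ex_derive _ _ _ _ _ _ _ dC).
rewrite /derive E; apply: etrans (@derive_val _ _ _ _ _ _ _ dC) _.
exact: mulrC.
Qed.

Variables (x : V) (S : {set V}) (c delta : R).
Hypothesis c01 : 0 <= c <= 1.
Hypothesis f_gt0 : 0 < f (pos x).
Hypothesis acute_edges : forall i k : 'I_n,
  c * (enorm (edge x S i) * enorm (edge x S k)) <=
    dotv (edge x S i) (edge x S k).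
Hypothesis delta_le : forall i, delta <= c * enorm (edge x S i) / f (pos x).

Lemma edge_cone_cos xi j : (forall i, 0 <= xi 0 i) ->
  c * (tau pos x S xi * enorm (edge x S j)) <=
    dotv (\sum_(i < n) xi 0 i *: edge x S i) (edge x S j).
Proof.
by move=> xi0; apply: enorm_cone_cos => //; case/andP: c01.
Qed.

Lemma mode_cost_increment xi j t : (forall i, 0 <= xi 0 i) -> 0 <= t ->
  mode_cost pos f x S xi + t * delta <=
    mode_cost pos f x S (xi + t *: delta_mx 0 j).
Proof.
move=> xi0 t0; rewrite /mode_cost /tau lincomb_add_delta.
apply: (@le_trans _ _
  ((tau pos x S xi + t * (c * enorm (edge x S j))) / f (pos x))).
  by rewrite mulrDl lerD2l -mulrA ler_wpM2l.
rewrite ler_pM2r ?invr_gt0//.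
exact: (enorm_increment c01 t0 (edge_cone_cos j xi0)).
Qed.

Lemma mode_cost_derive_ge xi j : 0 < delta -> Xi xi ->
  derivable (mode_cost pos f x S) xi (delta_mx 0 j) /\
  delta <= 'D_(delta_mx 0 j) (mode_cost pos f x S) xi.
Proof.
move=> delta0 [xi0 xi1].
(* On [Xi] the cost is at least [delta], so the norm is evaluated away from its singular point 0. *)
have tau0 : 0 < tau pos x S xi.
  have := cost_ge (@mode_cost_hom x S) mode_cost_increment xi0.
  rewrite xi1 mulr1 => /(lt_le_trans delta0).
  by rewrite /mode_cost pmulr_lgt0 ?invr_gt0.
have := tau0; rewrite enorm_gt0 => /(is_derive_mode_cost j) d.
split; first exact: (@ex_derive _ _ _ _ _ _ _ d).
rewrite (@derive_val _ _ _ _ _ _ _ d).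
apply: le_trans (delta_le j) _; rewrite ler_pM2r ?invr_gt0//.
by rewrite ler_pdivlMr// -mulrA [enorm _ * _]mulrC edge_cone_cos.
Qed.

End EikonalCost.

Theorem mainTheorem5 (R : realType) (n : nat) (n_gt0 : (0 < n)%N)
    (Omega : set 'rV[R]_n)
    (Omega_open : open Omega) (Omega_connected : connected Omega)
    (Omega_nonempty : Omega !=set0) (Omega_bounded : bounded_set Omega)
    (V : finType) (pos : V -> 'rV[R]_n) (mesh : {set {set V}})
    (mesh_tri : triangulation pos (closure Omega) mesh)
    (f : 'rV[R]_n -> R) (F1 F2 : R) (F1_gt0 : 0 < F1)
    (f_lip : [lipschitz f x | x in Omega])
    (f_bounds : forall x, Omega x -> F1 <= f x <= F2)
    (q : 'rV[R]_n -> R)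
    (q_lip : [lipschitz q x | x in closure Omega `\` Omega])
    (q_ge0 : forall x, (closure Omega `\` Omega) x -> 0 <= q x)
    (acute : max_angle pos Omega mesh < pi / 2) :
  let delta := min_edge pos mesh * cos (max_angle pos Omega mesh) / F2 in
  [/\ solves_discretization Omega pos mesh f q
        (fun x => value Omega pos mesh f q (Some x)),
      (forall x S, pos x \in Omega -> S \in modes mesh x ->
         absolutely_causal (mode_cost pos f x S))
      /\ applicable Omega pos mesh f q (dijkstra_step Omega pos mesh f),
      0 < delta,
      forall x S xi j, pos x \in Omega -> S \in modes mesh x -> Xi xi ->
        derivable (mode_cost pos f x S) xi (delta_mx 0 j)
        /\ delta <= 'D_(delta_mx 0 j) (mode_cost pos f x S) xi
    & applicable Omega pos mesh f q (dial_step Omega pos mesh f delta)].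
Proof.
move=> delta.
set b := max_angle pos Omega mesh in acute delta *.
(* Acuteness bounds [b] only from above; positivity of [cos b] also needs a lower bound. *)
have b0 : 0 <= b := max_angle_ge0 n_gt0 Omega_open mesh_tri.
have cb0 : 0 < cos b.
  rewrite cos_gt0_pihalf// acute andbT (lt_le_trans _ b0)//.
  by rewrite oppr_lt0 divr_gt0 ?pi_gt0.
have b_pi : b <= pi.
  apply: le_trans (ltW acute) _.
  by rewrite ler_pdivrMr// ler_peMr ?pi_ge0// ler1n.
have h0 : 0 < min_edge pos mesh := min_edge_gt0 n_gt0 mesh_tri Omega_nonempty.
have F2_gt0 : 0 < F2.
  have [p /f_bounds/andP[F1f fF2]] := Omega_nonempty.
  exact: lt_le_trans F1_gt0 (le_trans F1f fF2).
have delta_gt0 : 0 < delta by rewrite divr_gt0// mulr_gt0.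
have c01 : 0 <= cos b <= 1 by rewrite (ltW cb0) cos_le1.
have f_gt0 x : pos x \in Omega -> 0 < f (pos x).
  by rewrite inE => /f_bounds/andP[+ _]; exact: lt_le_trans.
have acute_edges x S (i k : 'I_n) : pos x \in Omega -> S \in modes mesh x ->
    cos b * (enorm (pos (mode_vertex x S i) - pos x) *
     enorm (pos (mode_vertex x S k) - pos x)) <=
    dotv (pos (mode_vertex x S i) - pos x) (pos (mode_vertex x S k) - pos x).
  by move=> xO Sx; exact: (mode_edges_acute mesh_tri i k xO Sx b_pi).
(* Here [delta] gets its constants: an edge is no shorter than the minimum edge-length, and [f] is
   at most [F2]. *)
have delta_le x S (i : 'I_n) : pos x \in Omega -> S \in modes mesh x ->
    delta <= cos b * enorm (pos (mode_vertex x S i) - pos x) / f (pos x).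
  move=> xO Sx; rewrite /delta [min_edge _ _ * _]mulrC.
  have /setD1P[zx zS] := mode_vertex_in mesh_tri i Sx.
  have /setIdP[Sm xS] := Sx.
  rewrite ler_pM ?mulr_ge0 ?invr_ge0 ?(ltW cb0) ?(ltW h0) ?(ltW F2_gt0)//.
    by rewrite ler_pM2l// (min_edge_le _ Sm).
  rewrite lef_pV2 ?posrE ?f_gt0//.
  by move: xO; rewrite inE => /f_bounds/andP[].
have incr x S (xi : 'rV[R]_n) j t : pos x \in Omega -> S \in modes mesh x ->
    (forall i, 0 <= xi 0 i) -> 0 <= t ->
    mode_cost pos f x S xi + t * delta <=
      mode_cost pos f x S (xi + t *: delta_mx 0 j).
  move=> xO Sx; apply: (mode_cost_increment c01) => //; first exact: f_gt0.
    by move=> i k; exact: acute_edges.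
  by move=> i; exact: delta_le.
have cost_delta x S (xi : 'rV[R]_n) : pos x \in Omega -> S \in modes mesh x ->
    Xi xi -> delta <= mode_cost pos f x S xi.
  move=> xO Sx [xi0 xi1]; rewrite -[leLHS]mulr1 -xi1.
  apply: cost_ge xi0; first by move=> *; exact: mode_cost_hom.
  by move=> *; exact: incr.
have q0 x : pos x \notin Omega -> 0 <= q (pos x).
  move=> xO; apply: q_ge0; split; first exact: (pos_closure mesh_tri).
  by move=> /mem_set; apply/negP.
have [W W0 W_sol] : exists2 W, (forall x, 0 <= W x) &
    finite_solution Omega pos mesh f q W.
  apply: (finite_solution_exists n_gt0 _
    (phi := fun x => pos x 0 (Ordinal n_gt0))) => //.
  - by move=> x S; exact: mode_cost_continuous.
  - by move=> x xO; exact: (mode_vertex_coord_gt Omega_open mesh_tri).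
  - move=> x S xi xO Sx Xxi; apply: le_trans (ltW delta_gt0) _.
    exact: cost_delta.
have valueE : (fun x => value Omega pos mesh f q (Some x)) = fun x => (W x)%:E.
  by apply/funext => x; apply: (value_finite_solution delta_gt0).
(* A step attaining [W x] is in particular a minimizer within its own mode, so the single-mode
   estimate applies. *)
have W_causal x S (xi : 'rV[R]_n) j : pos x \in Omega -> S \in modes mesh x ->
    Xi xi -> W x = step_value pos f W x S xi -> 0 < xi 0 j ->
    W (mode_vertex x S j) + delta <= W x.
  move=> xO Sx Xxi E xij; have := W_sol x; rewrite xO => -[_ Wmin].
  rewrite E step_value_objective.
  have -> : W (mode_vertex x S j) = (\row_k W (mode_vertex x S k)) 0 j.
    by rewrite mxE.
  apply: mode_minimizer_causal xij.
  - by move=> *; exact: mode_cost_hom.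
  - by move=> *; exact: incr.
  - by split=> // eta Xeta; rewrite -!step_value_objective -E; exact: Wmin.
split=> //.
- by rewrite valueE; exact: finite_solution_discretization.
- split; last first.
    by rewrite /applicable valueE; apply: (dijkstra_applicable delta_gt0).
  move=> x S xO Sx; apply: absolutely_causal_of_increment delta_gt0.
    by move=> *; exact: mode_cost_hom.
  by move=> *; exact: incr.
- move=> x S xi j xO Sx Xxi; apply: (mode_cost_derive_ge c01) => //.
  + exact: f_gt0.
  + by move=> i k; exact: acute_edges.
  + by move=> i; exact: delta_le.
- by rewrite /applicable valueE; apply: dial_applicable.
Qed.
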